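(* An Ockham algebra is quasi-primal if and only if its dual space is isomorphic to $\mathbb C_m$ for some odd number $m\ge 1$.
   Context: An Ockham algebra $\mathbf A=\langle A;\vee,\wedge,f,0,1\rangle$ is a bounded distributive lattice $\mathbf A^\flat=\langle A;\vee,\wedge,0,1\rangle$ with a unary operation $f$ satisfying $f(0)=1$, $f(1)=0$, $f(x\vee y)=f(x)\wedge f(y)$, $f(x\wedge y)=f(x)\vee f(y)$. An algebra is quasi-primal if it is finite, non-trivial (has more than one element) and has the ternary discriminator operation ($t(x,y,z)=z$ if $x=y$, and $t(x,y,z)=x$ if $x\neq y$) as a term function. An Ockham space is $\mathbb X=\langle X;g,\le,\mathcal T\rangle$ such that $\langle X;\le,\mathcal T\rangle$ is a Priestley space (an ordered compact topological space such that whenever $x\not\le y$ there is a clopen down-set $V$ with $x\notin V$ and $y\in V$) and $g\colon X\to X$ is continuous and order-reversing. Morphisms are continuous order-preserving maps that preserve $g$. The dual space $H(\mathbf A)$ of $\mathbf A$ is the set of all bounded-lattice homomorphisms $x\colon\mathbf A^\flat\to\mathbf 2$ into the two-element bounded lattice on $\{0,1\}$, ordered pointwise, with the topology inherited from the product $\{0,1\}^A$ of discrete spaces, and with $g(x)=(x\circ f)'$, where $'$ is Boolean complement on $\{0,1\}$. For odd $m\ge 1$, $\mathbb C_m$ is the Ockham space with underlying set $\{0,1,\dots,m-1\}$, ordered as an antichain, with discrete topology and $g(i)=i+1\pmod m$. *)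

(* Defs.v *)
From HB Require Import structures.
From mathcomp Require Import all_boot all_order.
From mathcomp Require Import all_classical topology.

Set Implicit Arguments.
Unset Strict Implicit.
Unset Printing Implicit Defensive.

Import Order.TTheory.

Local Open Scope classical_set_scope.
Local Open Scope order_scope.

HB.mixin Record TBDistrLattice_isOckham d A of Order.TBDistrLattice d A := {
  ockf : A -> A;
  ockf0 : ockf \bot = \top;
  ockf1 : ockf \top = \bot;
  ockfU : forall x y, ockf (x `|` y) = ockf x `&` ockf y;
  ockfI : forall x y, ockf (x `&` y) = ockf x `|` ockf y
}.

#[short(type="ockhamAlgType")]
HB.structure Definition OckhamAlgebra d :=
  { A of TBDistrLattice_isOckham d A & Order.TBDistrLattice d A }.

Inductive ockham_term (n : nat) : Type :=
  | TVar of 'I_n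
  | TBot
  | TTop
  | TJoin of ockham_term n & ockham_term n
  | TMeet of ockham_term n & ockham_term n
  | TOckf of ockham_term n.

Fixpoint term_eval d (A : ockhamAlgType d) n (t : ockham_term n)
    (v : n.-tuple A) : A :=
  match t with
  | TVar i => tnth v i
  | TBot => \bot
  | TTop => \top
  | TJoin t1 t2 => term_eval t1 v `|` term_eval t2 v
  | TMeet t1 t2 => term_eval t1 v `&` term_eval t2 v
  | TOckf t1 => ockf (term_eval t1 v)
  end.

Definition discriminator (A : eqType) (x y z : A) : A := if x == y then z else x.

Definition quasi_primal d (A : ockhamAlgType d) : Prop :=
  [/\ finite_set [set: A],
      exists x y : A, x <> y &
      exists t : ockham_term 3, forall x y z : A,
        term_eval t [tuple x; y; z] = discriminator x y z].

Definition down_set d (X : porderType d) (V : set X) : Prop :=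
  forall x y, x <= y -> V y -> V x.

HB.mixin Record POrderedTopological_isPriestley d X
    of POrderedTopological d X := {
  priestley_compact : compact [set: X];
  priestley_separation : forall x y : X, ~~ (x <= y) ->
    exists V : set X, [/\ clopen V, down_set V, ~ V x & V y]
}.

#[short(type="priestleyType")]
HB.structure Definition Priestley d :=
  { X of POrderedTopological_isPriestley d X & POrderedTopological d X }.

HB.mixin Record Priestley_isOckhamSpace d X of Priestley d X := {
  ockg : X -> X;
  ockg_continuous : continuous ockg;
  ockg_anti : {homo ockg : x y /~ x <= y}
}.

#[short(type="ockhamSpaceType")]
HB.structure Definition OckhamSpace d :=
  { X of Priestley_isOckhamSpace d X & Priestley d X }.

Definition ockham_morphism d (X : ockhamSpaceType d)
    d' (Y : ockhamSpaceType d') (phi : X -> Y) : Prop :=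
  [/\ continuous phi,
      {homo phi : x y / x <= y} &
      {morph phi : x / ockg x}].

Definition ockham_isomorphic d (X : ockhamSpaceType d)
    d' (Y : ockhamSpaceType d') : Prop :=
  exists (phi : X -> Y) (psi : Y -> X),
    [/\ ockham_morphism phi, ockham_morphism psi,
        cancel phi psi & cancel psi phi].

(* The library type {tblmorphism A -> bool} only requires the preservation of
   \bot and \top, not that of meets and joins, hence the explicit conditions. *)
Definition is_blattice_hom d (A : tbDistrLatticeType d) (x : A -> bool) : Prop :=
  [/\ Order.meet_morphism x, Order.join_morphism x, x \bot = \bot
    & x \top = \top].

Fact ockham_dual_display : Order.disp_t. Proof. exact: Order.Disp tt tt. Qed.

Definition ockham_dual d (A : ockhamAlgType d) : Type :=
  [set x : {ptws A -> bool} | is_blattice_hom x].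

Section OckhamDual.
Context d (A : ockhamAlgType d).
Local Notation H := (ockham_dual A).

HB.instance Definition _ := Topological.copy H
  [set x : {ptws A -> bool} | is_blattice_hom x].

Definition dual_fun (x : H) : A -> bool := val x.

Lemma dual_funP (x : H) : is_blattice_hom (dual_fun x).
Proof. exact: set_mem (valP x). Qed.

Lemma dual_fun_inj : injective dual_fun.
Proof. exact: val_inj. Qed.

Definition dual_mk (x : A -> bool) (hx : is_blattice_hom x) : H :=
  exist _ (x : {ptws A -> bool}) (mem_set hx).

Lemma dual_mkK (x : A -> bool) (hx : is_blattice_hom x) :
  dual_fun (dual_mk hx) = x.
Proof. by []. Qed.

Definition dual_le (x y : H) : bool :=
  `[< forall a, dual_fun x a <= dual_fun y a >].

Fact dual_le_refl : reflexive dual_le.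
Proof. by move=> x; apply/asboolP => a. Qed.

Fact dual_le_anti : antisymmetric dual_le.
Proof.
move=> x y /andP[/asboolP xy /asboolP yx]; apply: dual_fun_inj.
by apply/funext => a; apply/le_anti; rewrite xy yx.
Qed.

Fact dual_le_trans : transitive dual_le.
Proof.
move=> y x z /asboolP xy /asboolP yz; apply/asboolP => a.
exact: le_trans (xy a) (yz a).
Qed.

HB.instance Definition _ := Order.Le_isPOrder.Build ockham_dual_display H
  dual_le_refl dual_le_anti dual_le_trans.

Lemma dual_leP (x y : H) :
  reflect (forall a, dual_fun x a <= dual_fun y a) (x <= y).
Proof. exact: asboolP. Qed.

Lemma ptws_proj_continuous (a : A) :
  continuous (fun x : {ptws A -> bool} => x a).
Proof. exact: (@proj_continuous A (fun=> bool) a). Qed.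

Lemma dual_fun_continuous (a : A) : continuous (fun x : H => dual_fun x a).
Proof.
move=> x; apply: (@continuous_comp H {ptws A -> bool} bool
  (set_val : H -> {ptws A -> bool}) (fun x => x a)).
  exact: (@initial_continuous H {ptws A -> bool} set_val).
exact: ptws_proj_continuous.
Qed.

Lemma dual_continuous (T : topologicalType) (h : T -> H) :
  (forall a, continuous (fun t => dual_fun (h t) a)) -> continuous h.
Proof.
move=> hc; apply: (@continuous_comp_initial H T {ptws A -> bool} set_val).
move=> t; apply/cvg_sup => a; move: t.
apply/(@continuousP _ (initial_topology (fun x : A -> bool => x a))).
move=> _ [B oB <-].
have -> : (set_val \o h) @^-1` ((fun x : A -> bool => x a) @^-1` B) =
  (fun t => dual_fun (h t) a) @^-1` B by [].
by move/continuousP: (hc a); apply.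
Qed.

Lemma blattice_hom_closed :
  closed [set x : {ptws A -> bool} | is_blattice_hom x].
Proof.
have evb (b : bool) a : clopen [set x : {ptws A -> bool} | x a = b].
  apply: (@preimage_clopen {ptws A -> bool} bool (fun x => x a) [set b]).
    by split; [exact: discrete_open|exact: discrete_closed].
  exact: ptws_proj_continuous.
move=> x clx.
have ev (a : A) : nbhs x [set y : {ptws A -> bool} | y a = x a].
  by apply: open_nbhs_nbhs; split => //; case: (evb (x a) a).
split.
- move=> a b; have [y [[yI _ _ _] [/= ya [yb yab]]]] :=
    clx _ (filterI (ev a) (filterI (ev b) (ev (a `&` b)))).
  by rewrite -ya -yb -yab yI.
- move=> a b; have [y [[_ yU _ _] [/= ya [yb yab]]]] :=
    clx _ (filterI (ev a) (filterI (ev b) (ev (a `|` b)))).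
  by rewrite -ya -yb -yab yU.
- by have [y [[_ _ y0 _] /= <-]] := clx _ (ev \bot).
- by have [y [[_ _ _ y1] /= <-]] := clx _ (ev \top).
Qed.

Lemma dual_compact : compact [set: H].
Proof.
have cT : compact [set: {ptws A -> bool}].
  have := @tychonoff A (fun=> bool) (fun=> setT) (fun=> bool_compact).
  by congr (compact _); apply/seteqP; split.
have cH := subclosed_compact blattice_hom_closed cT (@subsetT _ _).
move=> F FF _.
have FH : (set_val @ F) [set x : {ptws A -> bool} | is_blattice_hom x].
  by apply: (@filterS _ F _ setT _ _ filterT) => z _; exact: dual_funP.
have [x [hx clx]] := cH (set_val @ F) (fmap_proper_filter _ FF) FH.
exists (dual_mk hx); split => // B U FB [_ [[W oW <-] /= Wx]] sWU.
have FB' : (set_val @ F) (set_val @` B).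
  by apply: (@filterS _ F _ B) FB => z Bz; exists z.
have [_ [[z Bz <-] Wz]] := clx _ W FB' (open_nbhs_nbhs (conj oW Wx)).
by exists z; split => //; exact: sWU.
Qed.

Lemma dual_separation (x y : H) : ~~ (x <= y) ->
  exists V : set H, [/\ clopen V, down_set V, ~ V x & V y].
Proof.
move/dual_leP/existsNP => [a /negP]; rewrite leEbool -ltnNge => yxa.
exists [set z | dual_fun z a = false]; split.
- apply: (@preimage_clopen H bool (fun z => dual_fun z a) [set false]).
    by split; [exact: discrete_open|exact: discrete_closed].
  exact: dual_fun_continuous.
- by move=> u v /dual_leP/(_ a) + /= va; rewrite va; case: (dual_fun u a).
- by move=> /= xa; move: yxa; rewrite xa.
- by move: yxa => /=; case: (dual_fun x a); case: (dual_fun y a).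
Qed.

HB.instance Definition _ :=
  POrderedTopological_isPriestley.Build _ H dual_compact dual_separation.

Fact dual_g_subproof (x : H) :
  is_blattice_hom (fun a => ~~ dual_fun x (ockf a)).
Proof.
have [xI xU x0 x1] := dual_funP x; split.
- by move=> a b; rewrite ockfI xU negb_or.
- by move=> a b; rewrite ockfU xI negb_and.
- by rewrite ockf0 x1.
- by rewrite ockf1 x0.
Qed.

Definition dual_g (x : H) : H := dual_mk (dual_g_subproof x).

Fact dual_g_continuous : continuous dual_g.
Proof.
apply: dual_continuous => a x.
apply: (@continuous_comp H bool bool (fun x => dual_fun x (ockf a)) negb).
  exact: dual_fun_continuous.
by move=> U /=; rewrite /nbhs /= => /principal_filterP ?; apply/principal_filterP.
Qed.

Fact dual_g_anti : {homo dual_g : x y /~ x <= y}.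
Proof.
move=> x y /dual_leP xy; apply/dual_leP => a; have := xy (ockf a).
by rewrite !dual_mkK; case: (dual_fun x _); case: (dual_fun y _).
Qed.

HB.instance Definition _ :=
  Priestley_isOckhamSpace.Build _ H dual_g_continuous dual_g_anti.

End OckhamDual.

(* An alias of 'I_m carrying the antichain order instead of the linear one. *)
Definition ockham_cycle (m : nat) : Type := 'I_m.

Fact ockham_cycle_display : Order.disp_t. Proof. exact: Order.Disp tt tt. Qed.

Section OckhamCycle.
Variable m : nat.
Local Notation C := (ockham_cycle m).

HB.instance Definition _ := DiscreteTopology.copy C (discrete_topology 'I_m).

Definition cycle_le (i j : C) : bool := i == j.

Fact cycle_le_refl : reflexive cycle_le.
Proof. exact: eqxx. Qed.

Fact cycle_le_anti : antisymmetric cycle_le.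
Proof. by move=> i j /andP[/eqP]. Qed.

Fact cycle_le_trans : transitive cycle_le.
Proof. by move=> j i k /eqP->. Qed.

HB.instance Definition _ := Order.Le_isPOrder.Build ockham_cycle_display C
  cycle_le_refl cycle_le_anti cycle_le_trans.

Lemma cycle_compact : compact [set: C].
Proof. by apply: finite_compact; exact: (@finite_finset 'I_m). Qed.

Lemma cycle_separation (i j : C) : ~~ (i <= j) ->
  exists V : set C, [/\ clopen V, down_set V, ~ V i & V j].
Proof.
move=> ij; exists [set j]; split => //.
- by split; [exact: discrete_open|exact: discrete_closed].
- by move=> k l /eqP->.
- by move=> /= ij'; move: ij; rewrite ij' lexx.
Qed.

HB.instance Definition _ :=
  POrderedTopological_isPriestley.Build _ C cycle_compact cycle_separation.

Definition cycle_g (i : C) : C := ordS i.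

Fact cycle_g_continuous : continuous cycle_g.
Proof.
by move=> i U; rewrite /= !nbhs_principalE /= => /principal_filterP ?;
  apply/principal_filterP.
Qed.

Fact cycle_g_anti : {homo cycle_g : i j /~ i <= j}.
Proof. by move=> i j /eqP->. Qed.

HB.instance Definition _ :=
  Priestley_isOckhamSpace.Build _ C cycle_g_continuous cycle_g_anti.

End OckhamCycle.

(* Main.v *)
Require Import Defs.
From mathcomp Require Import all_boot all_order all_classical topology.

(** Write H for the dual space of A and g for its order-reversing map, so that
x (f a) = ~ (g x) (a) for every x in H. Consequently
x (f^k a) is (g^k x) (a), negated when k is odd.

Suppose that A is quasi-primal, and let x be a point of H. The pairs (a, b)
with (g^k x) (a) <= (g^k x) (b) for even k and the reverse inequality for odd k
form a subalgebra of A x A that contains the diagonal and omits (1, 0). The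
discriminator forces a subalgebra containing the diagonal to be the diagonal
or all of A x A ([quasi_primal_compatible]), so this one is the diagonal. If
a and b agree at all points g^(2k) x, then (a, a /\ b) and (b, a /\ b) are such
pairs, whence a = b: the even orbit {g^(2k) x} separates the elements of A.
As A is finite, only the whole of H separates A
([finite_separating_full]), so the even orbit of every point is H
([even_orbit_full]). Applied to g x this gives x = g^(2k+1) x, an odd period.
Hence H is a single g-cycle of odd length; an odd power of g is both the
identity and order-reversing, so H is an antichain.

Conversely, let H be a cycle of odd length m. Elements of A are separated by
points of H ([prime_separation]), so A embeds in the finite algebra of subsets
of the cycle. There f^m is the Boolean complement, and f^(2k) with k < m moves
any point to any other because 2 is invertible modulo m. The join D of all
f^(2k) (a xor b) is therefore 1 when a <> b and 0 when a = b, and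
(D /\ a) \/ (f^m D /\ c) is the discriminator ([discriminator_termP]). *)

Set Implicit Arguments.
Unset Strict Implicit.
Unset Printing Implicit Defensive.

Import Order.TTheory.

Local Open Scope classical_set_scope.
Local Open Scope order_scope.

(** * Points of the dual space *)

Section DualPoints.
Context d (A : ockhamAlgType d).
Implicit Types (x y : ockham_dual A) (a b : A).

Lemma dual_funI x a b : dual_fun x (a `&` b) = dual_fun x a && dual_fun x b.
Proof. by have [xI _ _ _] := dual_funP x; rewrite xI. Qed.

Lemma dual_funU x a b : dual_fun x (a `|` b) = dual_fun x a || dual_fun x b.
Proof. by have [_ xU _ _] := dual_funP x; rewrite xU. Qed.

Lemma dual_fun0 x : dual_fun x \bot = false.
Proof. by have [_ _ -> _] := dual_funP x. Qed.

Lemma dual_fun1 x : dual_fun x \top = true.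
Proof. by have [_ _ _ ->] := dual_funP x. Qed.

Lemma dual_fun_le x a b : a <= b -> dual_fun x a -> dual_fun x b.
Proof. by move=> /meet_idPl ab; rewrite -{1}ab dual_funI => /andP[]. Qed.

Lemma dual_fun_ockf x a : dual_fun x (ockf a) = ~~ dual_fun (ockg x) a.
Proof. by rewrite /ockg /= negbK. Qed.

Lemma dual_fun_iter_ockf k x a :
  dual_fun x (iter k ockf a) = odd k (+) dual_fun (iter k ockg x) a.
Proof.
elim: k x => [//|k IH] x.
by rewrite iterS dual_fun_ockf IH -iterSr -addNb.
Qed.

(** The prime ideal theorem. A maximal set of elements whose finite meets with a
stay off the down-set of b is a prime filter: maximality means that c lies
outside it exactly when a /\ c /\ s <= b for some finite meet s of members, and
two such witnesses, for c and for e, combine by distributivity into one for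
c \/ e. *)
Lemma prime_separation a b : ~~ (a <= b) ->
  exists x, dual_fun x a /\ ~~ dual_fun x b.
Proof.
move=> ab.
pose compat (c : A) (F : set A) := forall s : seq A, (forall e, e \in s -> F e) ->
  ~~ (a `&` c `&` \meet_(e <- s) e <= b).
have [|F [PF maxF]] := @Zorn_bigcup A [set F | compat \top F].
  (* A finite subset of the union of a chain lies in one member of the chain,
     unless it is empty; the chain may then be empty too. *)
  move=> C CP Ctot [_|c s sC]; first by rewrite meetx1 big_nil meetx1.
  suff [X CX sX] : exists2 X, C X & forall e, e \in c :: s -> X e by exact: CP sX.
  have : forall e, e \in c :: s -> (\bigcup_(X in C) X) e by [].
  elim: s c {sC} => [|c' s IH] c sC.
    have [X CX Xc] := sC c (mem_head _ _).
    by exists X => // e; rewrite inE => /eqP->.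
  have [X CX Xc] := sC c (mem_head _ _).
  have [|Y CY sY] := IH c' => [e es|]; first by apply: sC; rewrite inE es orbT.
  have [XY|YX] := Ctot _ _ CX CY.
    by exists Y => // e; rewrite inE => /predU1P[->|/sY//]; exact: XY.
  by exists X => // e; rewrite inE => /predU1P[->//|/sY]; exact: YX.
have FE c : F c <-> compat c F.
  split=> [Fc s sF|cF].
    have := PF (c :: s); rewrite big_cons meetx1 meetA; apply => e.
    by rewrite inE => /predU1P[->|/sF].
  apply: contrapT => nFc; apply: (maxF (F `|` [set c])).
    by split=> [e Fe|/(_ c) cF']; [left|apply/nFc/cF'; right].
  move=> s sF; apply: contra (cF [seq e <- s | e != c] _) => [|e].
    move=> {sF}; rewrite meetx1; apply: le_trans.
    rewrite -meetA leI2 //; apply/meetsP_seq => e es _.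
    have [->|ec] := eqVneq e c; first exact: leIl.
    by rewrite (le_trans (leIr _ _)) // meets_inf_seq // mem_filter ec.
  by rewrite mem_filter => /andP[/eqP ec /sF[]].
have FD c e : c <= e -> F c -> F e.
  move=> ce /FE cF; apply/FE => s /cF; apply: contra; apply: le_trans.
  by rewrite leI2 // leI2.
pose x (c : A) : bool := `[< F c >].
have hx : is_blattice_hom x.
  split.
  - move=> c e; rewrite andEbool; apply/asboolP/andP => [Fce|[/asboolP Fc /asboolP Fe]].
      by split; apply/asboolP; apply: FD Fce; [exact: leIl|exact: leIr].
    apply/FE => s sF; have /FE/(_ (e :: s)) := Fc.
    rewrite big_cons !meetA; apply => k.
    by rewrite inE => /predU1P[->|/sF].
  - move=> c e; have -> : x c `|` x e = x c || x e by [].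
    apply/asboolP/orP; last first.
      by case=> /asboolP; apply: FD; [exact: leUl|exact: leUr].
    move=> Fce; apply: contrapT => /not_orP[nFc nFe].
    have nF k : ~ F k -> exists2 s : seq A, (forall e, e \in s -> F e) &
        a `&` k `&` \meet_(e <- s) e <= b.
      move=> nFk; apply: contrapT => h; apply: nFk; apply/FE => s sF.
      by apply/negP => sb; apply: h; exists s.
    have [s sF sb] := nF c (contra_not (@asboolT _) nFc).
    have [s' sF' sb'] := nF e (contra_not (@asboolT _) nFe).
    have /FE/(_ (s ++ s')) := Fce; rewrite big_cat /=.
    case/(_ _)/negP => [k|]; first by rewrite mem_cat => /orP[/sF|/sF'].
    rewrite meetUr meetUl leUx; apply/andP; split.
      by apply: le_trans sb; rewrite leI2 // leIl.
    by apply: le_trans sb'; rewrite leI2 // leIr.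
  - apply/asboolP => /FE/(_ [::])/(_ _)/negP[] //.
    by rewrite meetx0 meet0x le0x.
  - by apply/asboolP/FE.
exists (dual_mk hx); rewrite !dual_mkK; split.
  by apply/asboolP/FE => s /PF; rewrite meetx1 meetxx.
apply/asboolP => /FE/(_ [::])/(_ _)/negP[] //.
by rewrite -meetA meetCA leIl.
Qed.

Lemma dual_separates a b : (forall x, dual_fun x a = dual_fun x b) -> a = b.
Proof.
move=> ab; apply/le_anti/andP; split; apply/negPn/negP => /prime_separation[x].
  by rewrite ab => -[->].
by rewrite ab => -[->].
Qed.

(** The prime filter of x is principal when A is finite. Here p is its generator
and q the largest element outside it; a prime filter containing p but not q
contains everything above p and nothing below q. *)
Lemma finite_dual_isolated x : finite_set [set: A] ->
  exists p q, [/\ dual_fun x p, ~~ dual_fun x q &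
    forall y, dual_fun y p -> ~~ dual_fun y q -> y = x].
Proof.
move=> /finite_seqP[s sA].
have s_all a : a \in s by have : [set: A] a by []; rewrite sA.
exists (\meet_(a <- s | dual_fun x a) a), (\join_(a <- s | ~~ dual_fun x a) a).
split.
- elim/big_rec: _ => [|a b xa xb]; first by rewrite dual_fun1.
  by rewrite dual_funI xa.
- elim/big_rec: _ => [|a b xa xb]; first by rewrite dual_fun0.
  by rewrite dual_funU negb_or xa.
- move=> y yp yq; apply: dual_fun_inj; apply/funext => a.
  case: (boolP (dual_fun x a)) => xa.
    by apply: dual_fun_le yp; apply: meets_inf_seq.
  apply/negbTE; apply: contra yq; apply: dual_fun_le.
  exact: (@joins_sup_seq _ _ _ _ _ id).
Qed.

(** With p and q isolating x, a separating set must tell p from p /\ q, and only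
x does. *)
Lemma finite_separating_full (S : set (ockham_dual A)) : finite_set [set: A] ->
  (forall a b, (forall x, S x -> dual_fun x a = dual_fun x b) -> a = b) ->
  forall x, S x.
Proof.
move=> finA Ssep x; have [p [q [xp xq pqx]]] := finite_dual_isolated x finA.
apply: contrapT => nSx.
suff pq : p = p `&` q by move: xp; rewrite pq dual_funI (negbTE xq) andbF.
apply: Ssep => y Sy; rewrite dual_funI.
case yp: (dual_fun y p) => //; case yq: (dual_fun y q) => //.
by case: nSx; rewrite -(pqx y) ?yp ?yq.
Qed.

Lemma finite_dual_nbhs1 x : finite_set [set: A] -> nbhs x [set x].
Proof.
move=> finA; have [p [q [xp xq pqx]]] := finite_dual_isolated x finA.
have ev a : nbhs x [set y | dual_fun y a = dual_fun x a].
  apply: (@dual_fun_continuous _ A a x [set dual_fun x a]).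
  by rewrite /= nbhs_principalE; apply/principal_filterP.
apply: filterS (filterI (ev p) (ev q)) => y [/= yp yq].
by apply: pqx; rewrite ?yp ?yq.
Qed.

End DualPoints.

(** * Subalgebras of the square of a discriminator algebra *)

Section CompatibleRelations.
Context d (A : ockhamAlgType d).

(** R is a subalgebra of A x A. *)
Definition compatible (R : A -> A -> Prop) : Prop :=
  [/\ R \bot \bot, R \top \top,
      forall a a' b b', R a a' -> R b b' -> R (a `|` b) (a' `|` b'),
      forall a a' b b', R a a' -> R b b' -> R (a `&` b) (a' `&` b') &
      forall a a', R a a' -> R (ockf a) (ockf a')].

Lemma compatible_term_eval R n (t : ockham_term n) (v w : n.-tuple A) :
  compatible R -> (forall i, R (tnth v i) (tnth w i)) ->
  R (term_eval t v) (term_eval t w).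
Proof.
move=> [R0 R1 RU RI Rf] vw.
by elim: t => //= [t1 ? t2 ?|t1 ? t2 ?|t ?]; [exact: RU|exact: RI|exact: Rf].
Qed.

(** From one off-diagonal pair (a, b) and the diagonal, the discriminator
produces in turn (a, e) for every e, then (1, a), then (1, 0). *)
Lemma quasi_primal_compatible R : quasi_primal A -> compatible R ->
  (forall a, R a a) -> ~ R \top \bot -> forall a b, R a b -> a = b.
Proof.
move=> [_ _ [t tE]] cR Rr nR a b Rab; apply: contrapT => /eqP ab; apply: nR.
have Rd x x' y y' z z' : R x x' -> R y y' -> R z z' ->
    R (discriminator x y z) (discriminator x' y' z').
  move=> Rx Ry Rz; rewrite -!tE; apply: compatible_term_eval => // i.
  by case: i => [[|[|[|]]]] //= ?; rewrite !(tnth_nth \bot).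
have Ra e : R a e.
  have := Rd a b b b e e Rab (Rr b) (Rr e).
  by rewrite /discriminator eqxx (negbTE ab).
have Rc : R \top a.
  have := Rd a a a b \top \top (Rr a) Rab (Rr \top).
  by rewrite /discriminator eqxx (negbTE ab).
have [<-//|a1] := eqVneq a \top.
have := Rd \top a a a \bot \bot Rc (Rr a) (Rr \bot).
by rewrite /discriminator eqxx eq_sym (negbTE a1).
Qed.

End CompatibleRelations.

(** * The dual space of a quasi-primal algebra *)

Section QuasiPrimalDual.
Context d (A : ockhamAlgType d) (qpA : quasi_primal A).
Implicit Types (x y : ockham_dual A) (a b : A).

Lemma finite_carrier : finite_set [set: A].
Proof. by case: qpA. Qed.

(** The largest subalgebra of A x A inside the pairs with x a <= x b: since f
negates and shifts along the orbit, closure under f alternates the direction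
of the inequality. *)
Definition orbit_le x a b : Prop := forall k,
  if odd k then dual_fun (iter k ockg x) b -> dual_fun (iter k ockg x) a
  else dual_fun (iter k ockg x) a -> dual_fun (iter k ockg x) b.

Lemma orbit_le_eq x a b : orbit_le x a b -> a = b.
Proof.
apply: quasi_primal_compatible => //.
- split=> [k|k|e e' c c' Re Rc k|e e' c c' Re Rc k|e e' Re k].
  + by case: ifP.
  + by case: ifP.
  + by move: (Re k) (Rc k); rewrite !dual_funU; case: ifP => _ h h' /orP[/h|/h'] ->;
      rewrite ?orbT.
  + by move: (Re k) (Rc k); rewrite !dual_funI; case: ifP => _ h h' /andP[/h-> /h'->].
  + have := Re k.+1; rewrite !dual_fun_ockf /=; case: (odd k) => /= h;
      exact: contra.
- by move=> c k; case: ifP.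
- by move=> /(_ 0); rewrite /= dual_fun0 dual_fun1 => /(_ isT).
Qed.

(** If a and b agree on the even orbit of x, then a /\ b agrees with a at the even
places and lies below it at the odd ones, which is all that [orbit_le] asks. *)
Lemma even_orbit_full x y : exists k, y = iter k.*2 ockg x.
Proof.
apply: (finite_separating_full (S := [set z | exists k, z = iter k.*2 ockg x])).
  exact: finite_carrier.
suff meetE a b : (forall z, [set z | exists k, z = iter k.*2 ockg x] z ->
    dual_fun z a = dual_fun z b) -> a = a `&` b.
  move=> a b ab; rewrite (meetE a b ab) meetC -(meetE b a) // => z Sz.
  exact/esym/ab.
move=> ab; apply: (@orbit_le_eq x) => k.
rewrite dual_funI; case: ifP => [_ /andP[]//|/negbT ek].
suff -> : dual_fun (iter k ockg x) a = dual_fun (iter k ockg x) b.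
  by rewrite andbb.
by apply: ab; exists k./2; rewrite even_halfK.
Qed.

Lemma orbit_odd_period x : exists2 n, odd n & iter n ockg x = x.
Proof.
have [k xk] := even_orbit_full (ockg x) x.
by exists k.*2.+1; [rewrite /= odd_double|rewrite iterSr -xk].
Qed.

(** A common odd period of x and y turns x <= y into y <= x. *)
Lemma dual_antichain x y : x <= y -> x = y.
Proof.
move=> xy; have anti k (u v : ockham_dual A) : u <= v ->
    if odd k then iter k ockg v <= iter k ockg u
    else iter k ockg u <= iter k ockg v.
  move=> uv; elim: k => //= k; case: (odd k) => /=; exact: ockg_anti.
apply: le_anti; rewrite xy /=.
have [n on nx] := orbit_odd_period x; have [m om my] := orbit_odd_period y.
have per (p q : nat) (z : ockham_dual A) :
    iter p ockg z = z -> iter (p * q) ockg z = z.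
  by move=> pz; elim: q => [|q IH]; rewrite ?muln0 // mulnS iterD IH.
have := anti (n * m)%N x y xy; rewrite oddM on om /=.
by rewrite (per n m x nx) mulnC (per m n y my).
Qed.

(** The isomorphism sends i to g^i x0 for a base point x0, modulo the least period
of x0. Its inverse is continuous because a finite A has a discrete dual. *)
Lemma quasi_primal_dual_cycle :
  exists m, odd m /\ ockham_isomorphic (ockham_dual A) (ockham_cycle m).
Proof.
have [x0 _] : exists x : ockham_dual A, True.
  have [a [b ab]] : exists a b : A, a <> b by case: qpA.
  apply: contrapT => nH; apply: ab; apply: dual_separates => x.
  by case: nH; exists x.
have [p op px0] := orbit_odd_period x0.
pose per n := (0 < n)%N && (iter n ockg x0 == x0).
have exper : exists n, per n by exists p; rewrite /per px0 eqxx odd_gt0.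
case: (ex_minnP exper) => m /andP[m0 /eqP mx0] mmin {exper}.
have iterm n : iter (n %% m)%N ockg x0 = iter n ockg x0.
  rewrite {2}(divn_eq n m) addnC iterD; congr (iter _ _ _); elim: (n %/ m)%N => //= q IH.
  by rewrite mulSn iterD -IH mx0.
(* The least period divides the odd period p. *)
have om : odd m.
  have : (p %% m)%N = 0%N.
    apply/eqP; rewrite -leqn0 leqNgt; apply/negP => r0.
    have := mmin (p %% m)%N; rewrite /per r0 iterm px0 eqxx => /(_ isT).
    by rewrite leqNgt ltn_mod m0.
  by move/eqP/dvdn_odd; apply.
pose psi (i : ockham_cycle m) : ockham_dual A := iter (i : 'I_m) ockg x0.
have psi_inj : injective psi.
  have lt_neq (i j : 'I_m) : (i < j)%N -> psi i <> psi j.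
    move=> ij eij; have jm := ltn_ord j.
    have := mmin (i + (m - j))%N; rewrite /per addnC iterD -/(psi i) eij -iterD.
    rewrite subnK ?(ltnW jm) // mx0 eqxx addn_gt0 subn_gt0 jm => /(_ isT).
    by rewrite leqNgt -ltn_subRL (subKn (ltnW jm)) ij.
  move=> i j eij; apply: val_inj; case: (ltngtP i j) => // [/lt_neq|/lt_neq] h.
    by case: h.
  by case: h.
have psi_surj y : exists i, psi i = y.
  have [k ->] := even_orbit_full x0 y.
  by exists (Ordinal (ltn_pmod k.*2 m0)); rewrite /psi /= iterm.
pose phi y : ockham_cycle m := projT1 (cid (psi_surj y)).
have phiK : cancel phi psi by move=> y; rewrite /phi; case: cid.
have psiK : cancel psi phi by move=> i; apply: psi_inj; rewrite phiK.
have psig : {morph psi : i / ockg i}.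
  by move=> i; rewrite /psi /= iterm.
exists m; split=> //; exists phi, psi; split=> //; split.
- move=> y U /nbhs_singleton Uy.
  by apply: filterS (finite_dual_nbhs1 y finite_carrier) => _ ->.
- by move=> y z /dual_antichain->.
- by move=> y; apply: psi_inj; rewrite psig !phiK.
- move=> i U /nbhs_singleton Ui.
  by rewrite /= nbhs_principalE; apply/principal_filterP.
- by move=> i j /eqP->.
- exact: psig.
Qed.

End QuasiPrimalDual.

(** * Algebras whose dual space is an odd cycle *)

Section CycleDual.
Context d (A : ockhamAlgType d).
Implicit Types (x y : ockham_dual A) (a b : A).

Lemma finite_dual_finite_carrier (I : finType) (psi : I -> ockham_dual A) :
  (forall y, exists i, psi i = y) -> finite_set [set: A].
Proof.
move=> psi_surj; pose h a := [ffun i => dual_fun (psi i) a].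
have -> : [set: A] = h @^-1` [set: {ffun I -> bool}] by [].
apply: finite_preimage; last exact: finite_finset.
move=> a b _ _ /ffunP hab; apply: dual_separates => y.
by have [i <-] := psi_surj y; have := hab i; rewrite !ffunE.
Qed.

Definition iter_ockf_term n k (t : ockham_term n) : ockham_term n :=
  iter k (@TOckf n) t.

Lemma dual_fun_iter_ockf_term x n k (t : ockham_term n) v :
  dual_fun x (term_eval (iter_ockf_term k t) v) =
  odd k (+) dual_fun (iter k ockg x) (term_eval t v).
Proof.
by rewrite -dual_fun_iter_ockf; congr (dual_fun _ _); elim: k => //= k ->.
Qed.

Section DiscriminatorTerm.
Variable m : nat.

(** The symmetric difference of the first two variables, with f^m as the
complement. *)
Definition diff_term : ockham_term 3 :=
  TJoin (TMeet (TVar (inord 0)) (iter_ockf_term m (TVar (inord 1)))) (TMeet (TVar (inord 1)) (iter_ockf_term m (TVar (inord 0)))).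

(** The join of f^(2k) (a xor b) over k < m: even powers of f shift along the
cycle without negating, so the join spreads a difference between a and b at
one point to all points. *)
Definition differ_term : ockham_term 3 :=
  foldr (fun k => TJoin (iter_ockf_term k.*2 diff_term)) (TBot 3) (iota 0 m).

Definition discriminator_term : ockham_term 3 :=
  TJoin (TMeet differ_term (TVar (inord 0))) (TMeet (iter_ockf_term m differ_term) (TVar (inord 2))).

Hypothesis odd_m : odd m.
Hypothesis dual_period : forall x, iter m ockg x = x.
Hypothesis dual_transitive :
  forall x y, exists2 k, (k < m)%N & y = iter k.*2 ockg x.

Lemma dual_fun_compl_term x n (t : ockham_term n) v :
  dual_fun x (term_eval (iter_ockf_term m t) v) = ~~ dual_fun x (term_eval t v).
Proof. by rewrite dual_fun_iter_ockf_term odd_m dual_period. Qed.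

Lemma dual_fun_diff_term x a b c :
  dual_fun x (term_eval diff_term [tuple a; b; c]) = (dual_fun x a != dual_fun x b).
Proof.
rewrite /= dual_funU !dual_funI !dual_fun_compl_term /= !(tnth_nth \bot) /=.
by rewrite !inordK //=; case: (dual_fun x a); case: (dual_fun x b).
Qed.

Lemma dual_fun_differ_term x a b c :
  dual_fun x (term_eval differ_term [tuple a; b; c]) = (a != b).
Proof.
have -> : dual_fun x (term_eval differ_term [tuple a; b; c]) =
    has (fun k => dual_fun (iter k.*2 ockg x) a != dual_fun (iter k.*2 ockg x) b)
      (iota 0 m).
  rewrite /differ_term; elim: (iota 0 m) => [|k s IH]; first exact: dual_fun0.
  rewrite [foldr _ _ _]/= [term_eval _ _]/= dual_funU IH; congr (_ || _).
  by rewrite dual_fun_iter_ockf_term odd_double dual_fun_diff_term.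
apply/hasP/idP => [[k _]|]; first by apply: contraNneq => ->.
apply: contraNP => nab; apply/eqP/dual_separates => y.
have [k km ->] := dual_transitive x y; apply/eqP/negPn/negP => kab.
by apply: nab; exists k; rewrite ?mem_iota.
Qed.

Lemma discriminator_termP a b c :
  term_eval discriminator_term [tuple a; b; c] = discriminator a b c.
Proof.
apply: dual_separates => x; rewrite /discriminator_term [term_eval _ _]/=.
rewrite dual_funU !dual_funI dual_fun_compl_term dual_fun_differ_term.
rewrite !(tnth_nth \bot) !inordK //= /discriminator.
by case: eqP => _ //=; rewrite orbF.
Qed.

End DiscriminatorTerm.

Lemma cycle_dual_quasi_primal m : odd m ->
  ockham_isomorphic (ockham_dual A) (ockham_cycle m) -> quasi_primal A.
Proof.
move=> om [phi [psi [_ [_ _ psig] phiK _]]]; have m0 := odd_gt0 om.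
have iterE k (i : 'I_m) : (iter k (@ordS m) i : nat) = ((i + k) %% m)%N.
  elim: k => [|k IH]; first by rewrite addn0 modn_small.
  by rewrite /= IH addnS -addn1 modnDml addn1.
have iter_psi k (i : 'I_m) : iter k ockg (psi i) = psi (iter k (@ordS m) i).
  by elim: k => //= k ->; rewrite -psig.
split.
- by apply: (@finite_dual_finite_carrier 'I_m psi) => y; exists (phi y).
- exists \bot, \top => /(congr1 (dual_fun (psi (Ordinal m0)))).
  by rewrite dual_fun0 dual_fun1.
- exists (discriminator_term m); apply: discriminator_termP => // [x|x y].
    rewrite -[x]phiK iter_psi; congr psi; apply: (@ord_inj m).
    by rewrite iterE modnDr modn_small.
  (* (m + 1) / 2 is the inverse of 2 modulo m. *)
  exists (((phi y + (m - phi x)) * uphalf m) %% m)%N; first exact: ltn_pmod.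
  rewrite -[x in RHS]phiK iter_psi -[LHS]phiK; congr psi; apply: (@ord_inj m).
  rewrite iterE phiK -muln2 -modnDmr modnMml modnDmr -mulnA muln2 odd_uphalfK //.
  rewrite mulnS addnA addnCA subnKC ?(ltnW (ltn_ord _)) //.
  by rewrite -addnA -mulSn addnC modnMDl modn_small.
Qed.

End CycleDual.

Theorem theorem4p5 (d : Order.disp_t) (A : ockhamAlgType d) :
  quasi_primal A <->
  exists m : nat, odd m /\ ockham_isomorphic (ockham_dual A) (ockham_cycle m).
Proof.
split=> [|[m [om isoA]]]; first exact: quasi_primal_dual_cycle.
exact: cycle_dual_quasi_primal om isoA.
Qed.
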